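(* Let $q$ be a prime power, $m,k$ positive integers and $\rho\in\{1,\ldots,\min\{k,m\}\}$. Let $G'\in\mathbb{F}_{q^m}^{(k-\rho)\times m(k-\rho)}$ be a matrix whose columns are $\mathbb{F}_q$-linearly independent, and let $\mathcal{U}$ be the $[m(k-\rho)+\rho,k]_{q^m/q}$ system spanned over $\mathbb{F}_q$ by the columns of \[G=\begin{pmatrix} I_\rho & 0\\ 0 & G'\end{pmatrix}.\] Then $\mathcal{U}$ is rank-$\rho$-saturating. In particular, $s_{q^m/q}(k,\rho)\le m(k-\rho)+\rho$.
   Context: An $[n,k]_{q^m/q}$ system is an $n$-dimensional $\mathbb{F}_q$-subspace $\mathcal{U}\le\mathbb{F}_{q^m}^k$ with $\langle\mathcal{U}\rangle_{\mathbb{F}_{q^m}}=\mathbb{F}_{q^m}^k$; a generator matrix is a $k\times n$ matrix whose columns form an $\mathbb{F}_q$-basis of $\mathcal{U}$. Its linear set is $L_\mathcal{U}=\{\langle u\rangle_{\mathbb{F}_{q^m}}:u\in\mathcal{U}\setminus\{0\}\}\subseteq\mathrm{PG}(k-1,q^m)$. A point set $\mathcal{S}$ of $\mathrm{PG}(k-1,q^m)$ is $r$-saturating if every point lies in the span of some $r+1$ points of $\mathcal{S}$ and $r$ is minimal with this property; $\mathcal{U}$ is rank-$\rho$-saturating if $L_\mathcal{U}$ is $(\rho-1)$-saturating. For $\rho\in\{1,\ldots,\min\{k,m\}\}$, $s_{q^m/q}(k,\rho)$ denotes the minimum $n$ such that an $[n,k]_{q^m/q}$ rank-$\rho$-saturating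 system exists. *)

(* Defs.v *)
From HB Require Import structures.
From mathcomp Require Import all_boot all_order all_algebra all_field.
Set Implicit Arguments.
Unset Strict Implicit.
Unset Printing Implicit Defensive.
Import GRing.Theory.
Local Open Scope ring_scope.

(* Throughout, F is the finite field F_q and L its extension F_(q^m).  The    *)
(* space L^k carries two linear structures: as an F-space it is the canonical *)
(* vectType F on {ffun 'I_k -> L}, as an L-space it is 'cV[L]_k; lvec is the  *)
(* identification of the two carriers.                                        *)
Definition lvec (F : finFieldType) (L : fieldExtType F) (k : nat)
  (u : {ffun 'I_k -> L}) : 'cV[L]_k := \col_i u i.

Definition fcols (F : finFieldType) (L : fieldExtType F) (k n : nat)
  (G : 'M[L]_(k, n)) : n.-tuple {ffun 'I_k -> L} :=
  [tuple [ffun i => G i j] | j < n].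

(* The second conjunct says that the L-span of U, i.e., the least L-subspace  *)
(* containing U, is the whole of L^k.                                         *)
Definition is_system (F : finFieldType) (L : fieldExtType F) (n k : nat)
  (U : {vspace {ffun 'I_k -> L}}) : Prop :=
  \dim U = n /\
  (forall W : {vspace 'cV[L]_k},
     (forall u, u \in U -> lvec u \in W) -> W = fullv).

(* Points of PG(k-1, q^m) are the L-subspaces of 'cV[L]_k of dimension 1, and *)
(* point sets are Prop-valued predicates on {vspace 'cV[L]_k}.                *)
Definition linear_set (F : finFieldType) (L : fieldExtType F) (k : nat)
  (U : {vspace {ffun 'I_k -> L}}) (P : {vspace 'cV[L]_k}) : Prop :=
  exists u, [/\ u \in U, u != 0 & P = <[lvec u]>%VS].

Definition covered_by_spans (K : fieldType) (k : nat)
  (S : {vspace 'cV[K]_k} -> Prop) (r : nat) : Prop :=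
  forall P : {vspace 'cV[K]_k}, \dim P = 1%N ->
    exists Q : r.+1.-tuple {vspace 'cV[K]_k},
      [/\ uniq Q, forall i, S (tnth Q i) & (P <= \sum_i tnth Q i)%VS].

Definition saturating (K : fieldType) (k : nat)
  (S : {vspace 'cV[K]_k} -> Prop) (r : nat) : Prop :=
  covered_by_spans S r /\ (forall r', covered_by_spans S r' -> (r <= r')%N).

(* Only meaningful for 0 < rho, because of the truncated predecessor.         *)
Definition rank_saturating (F : finFieldType) (L : fieldExtType F) (k : nat)
  (rho : nat) (U : {vspace {ffun 'I_k -> L}}) : Prop :=
  saturating (linear_set U) rho.-1.

Definition rank_saturating_system (F : finFieldType) (L : fieldExtType F)
  (n k rho : nat) (U : {vspace {ffun 'I_k -> L}}) : Prop :=
  is_system n U /\ rank_saturating rho U.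

(* is_s L k rho s: the minimum s_{q^m/q}(k, rho) exists and is equal to s.    *)
Definition is_s (F : finFieldType) (L : fieldExtType F) (k rho s : nat) : Prop :=
  (exists U : {vspace {ffun 'I_k -> L}}, rank_saturating_system s rho U) /\
  (forall n, (exists U : {vspace {ffun 'I_k -> L}},
                rank_saturating_system n rho U) -> (s <= n)%N).

(* The k x (rho + m (k - rho)) matrix with diagonal blocks I_rho and G'; the  *)
(* cast only identifies rho + (k - rho) with k.                               *)
Definition block_gen (K : fieldType) (m k rho : nat) (le_rho_k : (rho <= k)%N)
  (G' : 'M[K]_(k - rho, m * (k - rho))) : 'M[K]_(k, rho + m * (k - rho)) :=
  castmx (subnKC le_rho_k, erefl) (block_mx 1%:M 0 0 G').

(* Main.v *)
Require Import Defs.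
From HB Require Import structures.
From mathcomp Require Import all_boot all_order all_algebra all_field.
From Stdlib Require Import Classical.
Set Implicit Arguments.
Unset Strict Implicit.
Unset Printing Implicit Defensive.
Import GRing.Theory.
Local Open Scope ring_scope.

(* The columns of G' form an F-basis of the whole of L^(k - rho), so U is the *)
(* set of vectors whose first rho coordinates lie in F.  A nonzero vector v   *)
(* is an L-combination of rho - 1 of the first rho unit vectors and of one    *)
(* further element of U, a multiple of v with the corresponding coordinates   *)
(* erased.  Conversely, if v has first rho coordinates linearly independent   *)
(* over F and is an L-combination of n elements of U, then these coordinates  *)
(* lie in the F-span of the n coefficients, whence rho <= n.                  *)

(** Gives the existence of the minimum in [is_s]: that predicate quantifies over subspaces and
    Prop-valued point sets, so excluded middle replaces a decision procedure. *)
Lemma classical_ex_min (P : nat -> Prop) (n : nat) : P n ->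
  exists2 s, P s /\ (forall j, P j -> (s <= j)%N) & (s <= n)%N.
Proof.
elim/ltn_ind: n => n IHn Pn.
case: (classic (exists2 j, P j & (j < n)%N)) => [[j Pj lt_jn]|no_less].
  have [s minPs le_sj] := IHn j lt_jn Pj.
  by exists s => //; apply: leq_trans le_sj (ltnW lt_jn).
exists n => //; split=> // j Pj; rewrite leqNgt; apply/negP => lt_jn.
by apply: no_less; exists j.
Qed.

(** * Spans and independence over [F] of the columns of a matrix over [L] *)

Section Columns.

Variables (F : finFieldType) (L : fieldExtType F).

Lemma sum_fcols (k n : nat) (G : 'M[L]_(k, n)) (c : 'I_n -> F) :
  \sum_j c j *: (fcols G)`_j = [ffun i => \sum_j c j *: G i j].
Proof.
apply/ffunP=> i; rewrite sum_ffunE ffunE; apply: eq_bigr => j _.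
by rewrite ffunE -tnth_nth tnth_mktuple ffunE.
Qed.

Lemma mem_span_fcolsP (k n : nat) (G : 'M[L]_(k, n)) (u : {ffun 'I_k -> L}) :
  (exists c : 'I_n -> F, forall i, u i = \sum_j c j *: G i j) <->
  u \in <<fcols G>>%VS.
Proof.
split=> [[c def_u] | u_in].
  have -> : u = \sum_j c j *: (fcols G)`_j.
    by rewrite sum_fcols; apply/ffunP=> i; rewrite ffunE.
  by apply: rpred_sum => j _; apply/rpredZ/memv_span; rewrite -tnth_nth mem_tnth.
exists (fun j => coord (fcols G) j u) => i.
by rewrite {1}(coord_span u_in) sum_fcols ffunE.
Qed.

Lemma free_fcolsP (k n : nat) (G : 'M[L]_(k, n)) :
  (forall c : 'I_n -> F, (forall i, \sum_j c j *: G i j = 0) -> c =1 (fun=> 0))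
  <-> free (fcols G).
Proof.
split=> [freeG | /freeP freeG c c0].
  apply/freeP => c; rewrite sum_fcols => /ffunP c0 j.
  by apply: freeG => i; have:= c0 i; rewrite !ffunE.
by move=> j; apply: freeG; rewrite sum_fcols; apply/ffunP=> i; rewrite !ffunE.
Qed.

Lemma dim_ffun (k : nat) :
  \dim {:{ffun 'I_k -> L}} = (\dim {:L} * k)%N.
Proof. by rewrite !dimvf /dim /= card_ord mulnC. Qed.

(** The number of columns is the [F]-dimension of $L^k$, so independence already makes them a
    basis. *)
Lemma span_free_fcols (k : nat) (G : 'M[L]_(k, \dim {:L} * k)) :
  free (fcols G) -> <<fcols G>>%VS = fullv.
Proof.
move=> /eqnP dimG; apply/eqP.
by rewrite eqEdim subvf /= dimG size_tuple dim_ffun.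
Qed.

Lemma exists_free_fcols (k : nat) :
  exists G : 'M[L]_(k, \dim {:L} * k), free (fcols G).
Proof.
have [b freeb] : exists b : (\dim {:L} * k).-tuple {ffun 'I_k -> L}, free b.
  by rewrite -dim_ffun; exists (vbasis fullv); apply: basis_free (vbasisP _).
exists (\matrix_(i, j) tnth b j i).
have -> // : fcols (\matrix_(i, j) tnth b j i) = b.
apply: eq_from_tnth => j; rewrite tnth_mktuple.
by apply/ffunP=> i; rewrite ffunE mxE.
Qed.

End Columns.

(** * Head coordinates (the first [rho]) and tail coordinates *)

Section Blocks.

Variables (F : finFieldType) (L : fieldExtType F) (k rho : nat).
Hypothesis le_rho_k : (rho <= k)%N.

Definition head_ord (i : 'I_rho) : 'I_k :=
  cast_ord (subnKC le_rho_k) (lshift (k - rho) i).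

Definition tail_ord (i : 'I_(k - rho)) : 'I_k :=
  cast_ord (subnKC le_rho_k) (rshift rho i).

Variant head_tail_spec : 'I_k -> Type :=
  | IsHead i : head_tail_spec (head_ord i)
  | IsTail i : head_tail_spec (tail_ord i).

Lemma head_tailP (l : 'I_k) : head_tail_spec l.
Proof.
rewrite -[l](cast_ordKV (subnKC le_rho_k)).
by case: (split_ordP (cast_ord (esym (subnKC le_rho_k)) l)) => i ->; constructor.
Qed.

Lemma head_ord_inj : injective head_ord.
Proof. by move=> i j /cast_ord_inj/lshift_inj. Qed.

Lemma sum_block_gen_head (m : nat) (G' : 'M[L]_(k - rho, m * (k - rho)))
    (c : 'I_(rho + m * (k - rho)) -> F) (i : 'I_rho) :
  \sum_j c j *: block_gen le_rho_k G' (head_ord i) j = (c (lshift _ i))%:A.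
Proof.
rewrite big_split_ord /= [X in _ + X]big1 => [|j _]; last first.
  by rewrite castmxE cast_ordK cast_ord_id block_mxEur mxE scaler0.
rewrite addr0 (bigD1 i) //= big1 => [|j /negPf ji].
  by rewrite addr0 castmxE cast_ordK cast_ord_id block_mxEul mxE eqxx.
by rewrite castmxE cast_ordK cast_ord_id block_mxEul mxE eq_sym ji scaler0.
Qed.

Lemma sum_block_gen_tail (m : nat) (G' : 'M[L]_(k - rho, m * (k - rho)))
    (c : 'I_(rho + m * (k - rho)) -> F) (i : 'I_(k - rho)) :
  \sum_j c j *: block_gen le_rho_k G' (tail_ord i) j =
  \sum_j c (rshift _ j) *: G' i j.
Proof.
rewrite big_split_ord /= big1 ?add0r => [|j _]; last first.
  by rewrite castmxE cast_ordK cast_ord_id block_mxEdl mxE scaler0.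
by apply: eq_bigr => j _; rewrite castmxE cast_ordK cast_ord_id block_mxEdr.
Qed.

Lemma free_block_gen (m : nat) (G' : 'M[L]_(k - rho, m * (k - rho))) :
  free (fcols G') -> free (fcols (block_gen le_rho_k G')).
Proof.
move=> /free_fcolsP freeG'; apply/free_fcolsP => c c0 j.
case: (split_ordP j) => {}j ->.
  have /eqP := c0 (head_ord j); rewrite sum_block_gen_head.
  by rewrite scaler_eq0 oner_eq0 orbF => /eqP.
apply: (freeG' (c \o @rshift rho _)) => i.
by rewrite -[RHS](c0 (tail_ord i)) sum_block_gen_tail.
Qed.

(** The identity block puts arbitrary elements of [F], embedded in [L] as [1%VS], in the head; the
    columns of [G'] span $L^{k-\rho}$ over [F], so the tail is unconstrained. *)
Lemma mem_span_block_gen (G' : 'M[L]_(k - rho, \dim {:L} * (k - rho)))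
    (u : {ffun 'I_k -> L}) : free (fcols G') ->
  u \in <<fcols (block_gen le_rho_k G')>>%VS <->
  (forall i, u (head_ord i) \in 1%VS).
Proof.
move=> /span_free_fcols fullG'; split=> [/mem_span_fcolsP[c def_u] i | u_head].
  by rewrite def_u sum_block_gen_head rpredZ ?mem1v.
have [a def_a] := fin_all_exists (fun i => vlineP _ _ (u_head i)).
have [b def_b] : exists b : 'I_(\dim {:L} * (k - rho)) -> F,
    forall i, [ffun i => u (tail_ord i)] i = \sum_j b j *: G' i j.
  by apply/mem_span_fcolsP; rewrite fullG' memvf.
apply/mem_span_fcolsP.
exists (fun j => match split j with inl i => a i | inr i => b i end) => l.
case: (head_tailP l) => i.
  by rewrite sum_block_gen_head -[lshift _ _]/(unsplit (inl i)) unsplitK def_a.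
rewrite sum_block_gen_tail; have := def_b i; rewrite ffunE => ->.
by apply: eq_bigr => j _; rewrite -[rshift _ _]/(unsplit (inr j)) unsplitK.
Qed.

(** The unit vectors have coordinates 0 and 1, hence lie in [U], and they span $L^k$ over [L]. *)
Lemma lspan_head_scalar (U : {vspace {ffun 'I_k -> L}}) (W : {vspace 'cV[L]_k}) :
    (forall u : {ffun 'I_k -> L}, (forall i, u (head_ord i) \in 1%VS) -> u \in U) ->
  (forall u, u \in U -> lvec u \in W) -> W = fullv.
Proof.
move=> U_head UW; apply/eqP; rewrite eqEsubv subvf /=; apply/subvP => w _.
have -> : w = \sum_l w l 0 *: lvec [ffun j => (j == l)%:R].
  apply/colP=> i; rewrite summxE (bigD1 i) //= big1 => [|j /negPf ji].
    by rewrite !mxE ffunE eqxx mulr1 addr0.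
  by rewrite !mxE ffunE eq_sym ji mulr0.
apply: rpred_sum => l _; apply/rpredZ/UW/U_head => i.
by rewrite ffunE; apply: rpred_nat.
Qed.

(** The test point has [rho] elements of an [F]-basis of [L] as its head, which is possible because
    [rho] is at most the degree of [L]. *)
Lemma covered_by_spans_ge (U : {vspace {ffun 'I_k -> L}}) (r : nat) :
    (forall u, u \in U -> forall i, u (head_ord i) \in 1%VS) ->
    (0 < rho <= \dim {:L})%N ->
  covered_by_spans (linear_set U) r -> (rho <= r.+1)%N.
Proof.
move=> U_head /andP[rho_gt0 le_rho_m] covU.
pose al := take rho (vbasis {:L}).
have size_al : size al = rho.
  by rewrite size_takel // size_tuple.
have free_al : free al.
  have := basis_free (vbasisP {:L}).
  by rewrite -[X in free X](cat_take_drop rho) => /catl_free.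
(* Since [al] has size [rho], the default value 0 fills the tail. *)
pose x : 'cV[L]_k := \col_l al`_l.
have x_neq0 : x != 0.
  have al0 : al`_0 != 0.
    by apply: (free_not0 free_al); rewrite mem_nth ?size_al.
  apply: contraNneq al0 => /colP/(_ (head_ord (Ordinal rho_gt0))).
  by rewrite !mxE /= => ->.
have [|Q [_ QU]] := covU <[x]>%VS; first by rewrite dim_vline x_neq0.
have [u def_u] := fin_all_exists QU.
rewrite -memvE => /memv_sumP[w wQ def_x].
have w_line j : exists c, w j = c *: lvec (u j).
  by have [_ _ Qj] := def_u j; have := wQ j isT; rewrite Qj => /vlineP.
have [c def_w] := fin_all_exists w_line.
pose X := [tuple c j | j < r.+1].
(* Head coordinates of the [u j] are in [F], so each entry of [al] is an [F]-combination of the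
   [r.+1] coefficients [c j]. *)
suff: (<<al>> <= <<X>>)%VS.
  move/dimvS; rewrite (eqnP free_al) size_al => /leq_trans-> //.
  by rewrite (leq_trans (dim_span _)) ?size_tuple.
apply/span_subvP => a /(nthP 0)[i]; rewrite size_al => lt_i <-.
have -> : al`_i = \sum_j c j * u j (head_ord (Ordinal lt_i)).
  have := congr1 (fun z : 'cV_k => z (head_ord (Ordinal lt_i)) 0) def_x.
  rewrite !mxE /= => ->; rewrite summxE; apply: eq_bigr => j _.
  by rewrite def_w !mxE.
apply: rpred_sum => j _; have [uU _ _] := def_u j.
have /vlineP[b ->] := U_head _ uU (Ordinal lt_i).
rewrite -scalerAr mulr1; apply/rpredZ/memv_span.
by apply/mapP; exists j; rewrite ?mem_enum.
Qed.

(* The multiple z *: v will be used as a point of the linear set after its    *)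
(* head coordinates other than i0 have been erased; l witnesses that it then  *)
(* remains nonzero.                                                           *)
Lemma head_pivot (v : 'cV[L]_k) : (0 < rho)%N -> v != 0 ->
  exists i0 z l, [/\ z != 0, z * v (head_ord i0) 0 \in 1%VS,
    (forall i, i != i0 -> l != head_ord i) & v l 0 != 0].
Proof.
move=> rho_gt0 v_neq0.
(* A nonzero head coordinate is scaled to 1 and is itself the surviving one; if the head vanishes,
   any [i0] serves with [z = 1], and a nonzero coordinate lies in the tail. *)
have [i0 vi0 | v_head] := pickP (fun i => v (head_ord i) 0 != 0).
  exists i0, (v (head_ord i0) 0)^-1, (head_ord i0).
  rewrite invr_eq0 mulVf // mem1v; split=> // i.
  by apply: contra => /eqP/head_ord_inj->.
have /cV0Pn[l vl] := v_neq0.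
exists (Ordinal rho_gt0), 1, l; split=> //; first exact: oner_neq0.
  by rewrite (eqP (negbFE (v_head _))) mulr0 mem0v.
by move=> i _; apply: contraNneq vl => ->; rewrite (eqP (negbFE (v_head i))).
Qed.

End Blocks.

(** Here [rho] is [r.+1]. Among the head unit vectors, the one at [i0] is replaced by the erased
    multiple of [v]; the other [r] supply the erased coordinates. *)
Lemma covered_by_spans_head (F : finFieldType) (L : fieldExtType F) (k r : nat)
    (lt_r_k : (r < k)%N) (U : {vspace {ffun 'I_k -> L}}) :
    (forall u : {ffun 'I_k -> L}, (forall i, u (head_ord lt_r_k i) \in 1%VS) -> u \in U) ->
  covered_by_spans (linear_set U) r.
Proof.
set h := head_ord lt_r_k => U_head P dimP.
pose v := vpick P; have v_neq0 : v != 0 by rewrite vpick0 -dimv_eq0 dimP.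
have def_P : P = <[v]>%VS.
  apply/esym/eqP; rewrite eqEdim -memvE memv_pick dimP.
  by rewrite dim_vline v_neq0.
have [i0 [z [l [z_neq0 zv l_neq vl]]]] := head_pivot lt_r_k (ltn0Sn r) v_neq0.
pose erased (j : 'I_k) := [exists i : 'I_r.+1, (i != i0) && (j == h i)].
pose u (i : 'I_r.+1) : {ffun 'I_k -> L} :=
  if i == i0 then [ffun j => if erased j then 0 else z * v j 0]
  else [ffun j => (j == h i)%:R].
have erased_h i : erased (h i) = (i != i0).
  apply/existsP/idP => [[j /andP[ji0 /eqP/head_ord_inj->]] // | ii0].
  by exists i; rewrite ii0 eqxx.
(* For [i != i0] the coordinate [h i] singles out [u i] among all the vectors; this is what makes
   the points of the tuple distinct. *)
have u_h i j : i != i0 -> u j (h i) = (i == j)%:R.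
  rewrite /u => ii0; have [->|_] := eqVneq j i0.
    by rewrite ffunE erased_h ii0 (negPf ii0).
  by rewrite ffunE (inj_eq (@head_ord_inj _ _ _)).
have uU i : u i \in U.
  apply: U_head => j; have [-> | jj0] := eqVneq j i0; last first.
    by rewrite u_h //; apply: rpred_nat.
  rewrite /u; case: eqP => _; rewrite ffunE; last exact: rpred_nat.
  by rewrite -/h erased_h eqxx.
have u_neq0 i : u i != 0.
  have [->|ii0] := eqVneq i i0; last first.
    apply/eqP => /ffunP/(_ (h i)); rewrite u_h // eqxx ffunE.
    by apply/eqP/oner_neq0.
  apply/eqP => /ffunP/(_ l); rewrite /u eqxx !ffunE ifN.
    by move/eqP; rewrite mulf_eq0 (negPf z_neq0) (negPf vl).
  by apply/existsP => -[i1 /andP[/l_neq/negP l1 /l1]].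
have line_neq i j : i != i0 -> i != j -> <[lvec (u i)]>%VS <> <[lvec (u j)]>%VS.
  move=> ii0 ij eq_ij; have : lvec (u i) \in <[lvec (u j)]>%VS.
    by rewrite -eq_ij memv_line.
  case/vlineP=> c /colP/(_ (h i)); rewrite !mxE !u_h // eqxx (negPf ij) mulr0.
  by apply/eqP/oner_neq0.
exists [tuple <[lvec (u i)]>%VS | i < r.+1]; split.
- rewrite map_inj_uniq ?enum_uniq // => i j eq_ij; apply/eqP.
  apply/negPn/negP => ij; have [ii0|ii0] := eqVneq i i0.
    by apply: (line_neq j i); rewrite 1?eq_sym // -ii0.
  exact: line_neq ii0 ij eq_ij.
- by move=> i; rewrite tnth_mktuple; exists (u i).
rewrite def_P -memvE.
(* The factor [z^-1] restores the coordinates that were kept, and the entries [v (h i) 0] refill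
   those that were erased. *)
have -> : v = \sum_i (if i == i0 then z^-1 else v (h i) 0) *: lvec (u i).
  apply/colP=> j; rewrite summxE (bigD1 i0) //= eqxx !mxE /u eqxx ffunE.
  case: ifP => [/existsP[i /andP[ii0 /eqP->]] | not_erased].
    rewrite mulr0 add0r (bigD1 i) //= big1 => [|i1 /andP[/negPf i1i0 i1i]].
      by rewrite (negPf ii0) !mxE ffunE eqxx mulr1 addr0.
    rewrite i1i0 !mxE ffunE (inj_eq (@head_ord_inj _ _ _)).
    by rewrite eq_sym (negPf i1i) mulr0.
  rewrite mulKf // big1 ?addr0 // => i ii0.
  rewrite (negPf ii0) !mxE ffunE; case: eqP => [ji|]; last by rewrite mulr0.
  by case/existsP: not_erased; exists i; rewrite ii0 ji /=.
apply: memv_sumr => i _.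
by rewrite tnth_mktuple rpredZ ?memv_line.
Qed.

Theorem theorem3p4 (F : finFieldType) (L : fieldExtType F) (q m k rho : nat)
  (card_F : #|F| = q) (dim_L : \dim {:L} = m)
  (m_gt0 : (0 < m)%N) (k_gt0 : (0 < k)%N) (rho_gt0 : (1 <= rho)%N)
  (le_rho_k : (rho <= k)%N) (le_rho_m : (rho <= m)%N) :
  (forall G' : 'M[L]_(k - rho, m * (k - rho)),
     free (fcols G') ->
     rank_saturating_system (m * (k - rho) + rho) rho
       <<fcols (block_gen le_rho_k G')>>%VS) /\
  (exists2 s : nat, is_s L k rho s & (s <= m * (k - rho) + rho)%N).
Proof.
have main (G' : 'M[L]_(k - rho, m * (k - rho))) : free (fcols G') ->
     rank_saturating_system (m * (k - rho) + rho) rho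
       <<fcols (block_gen le_rho_k G')>>%VS.
  move=> freeG'; move: (free_block_gen le_rho_k freeG') => /eqnP dimU.
  have U_head u : u \in <<fcols (block_gen le_rho_k G')>>%VS <->
      (forall i, u (head_ord le_rho_k i) \in 1%VS).
    (* Replacing [m] by the dimension of [L] gives [G'] the type that [mem_span_block_gen]
       expects. *)
    by case: m / dim_L G' freeG' {m_gt0 le_rho_m dimU} => G' /mem_span_block_gen.
  (* From here on only the dimension of [U] and the description by head coordinates matter. *)
  move: (<<_>>%VS) dimU U_head => U dimU U_head.
  split; first split.
  - by rewrite dimU size_tuple addnC.
  - by move=> W; apply: (@lspan_head_scalar _ _ _ _ le_rho_k) => u /U_head.
  split.
    case: rho rho_gt0 le_rho_k {le_rho_m dimU G' freeG'} U_head => // r _ lt_r_k.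
    by move=> U_head; apply: (@covered_by_spans_head _ _ _ _ lt_r_k) => u /U_head.
  move=> r /(@covered_by_spans_ge _ _ _ _ le_rho_k); rewrite -subn1 leq_subLR add1n.
  by apply; [move=> u /U_head | rewrite rho_gt0 dim_L].
split=> //; apply: classical_ex_min.
(* The bound on the minimum requires at least one admissible [G']. *)
have [G' freeG'] : exists G' : 'M[L]_(k - rho, m * (k - rho)), free (fcols G').
  by rewrite -dim_L; apply: exists_free_fcols.
by exists <<fcols (block_gen le_rho_k G')>>%VS; apply: main.
Qed.
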